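(* Let $n\ge 1$ and let $a=(a_1,a_2,\dots,a_n)$ and $b=(b_1,b_2,\dots,b_n)$ be two $n$-digit natural numbers written in decimal, where for integers $x_1,\dots,x_m$ the notation $(x_1,\dots,x_m)$ denotes $\sum_{i=1}^m x_i 10^{m-i}$ (entries are allowed to be arbitrary integers, including negative ones or ones exceeding $9$). Let $C_i=a_ib_i$ for $i=1,\dots,n$ (the vertical product $C=(C_1,\dots,C_n)$). For $k=1,\dots,2n-1$ let $$K_k=\sum_{\substack{1\le i<j\le n\\ i+j=k+1}}(a_i-a_j)(b_i-b_j),$$ so that $K_1=K_{2n-1}=0$, $K_k=K_{12\cdots k}$ for $2\le k\le n$ and $K_k=K_{(k-n+1)\cdots n}$ for $n\le k\le 2n-2$ (symmetric differences of consecutive index ranges), and let the tare be $K=(K_1,K_2,\dots,K_{2n-1})=(0,K_{12},K_{123},\dots,K_{12\cdots n},K_{2\cdots n},\dots,K_{n-1,n},0)$. Then $$(a_1,a_2,\dots,a_n)\times(b_1,b_2,\dots,b_n)=(C_1,C_2,\dots,C_n)\times(\underbrace{1,1,\dots,1}_{n})-K,$$ that is, $a\times b=\Big(\sum_{i=1}^n C_i10^{n-i}\Big)\Big(\sum_{j=0}^{n-1}10^j\Big)-\sum_{k=1}^{2n-1}K_k10^{2n-1-k}$.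
   Context: For a consecutive index range $p,p+1,\dots,q$, the symmetric difference is $K_{p\cdots q}=\sum_{p\le i<j\le q,\ i+j=p+q}(a_i-a_j)(b_i-b_j)$, i.e. the sum of the difference products $K_{ij}=(a_i-a_j)(b_i-b_j)$ over the symmetric pairs of the range (the middle index, if any, is omitted). *)

(* Defs.v *)
From mathcomp Require Import all_boot all_order all_algebra.

Set Implicit Arguments.
Unset Strict Implicit.
Unset Printing Implicit Defensive.

Import Order.TTheory GRing.Theory Num.Theory.
Local Open Scope ring_scope.

(* Sequences are read as (x_1, ..., x_m), with indices starting at 1;
   entry x 0 is junk and is never used below. *)
Definition entry (x : seq int) (i : nat) : int := x`_(i.-1).

(* (x_1, ..., x_m) as a number: the entries are arbitrary integers, so this is
   not restricted to genuine decimal digits. *)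
Definition decval (x : seq int) : int :=
  \sum_(1 <= i < (size x).+1) entry x i * 10 ^+ (size x - i).

(* Leading zeros are allowed, so numbers of different lengths can be padded. *)
Definition is_digit_seq (x : seq int) : bool :=
  all (fun d : int => (0 <= d) && (d <= 9)) x.

Definition vertical_product (n : nat) (a b : seq int) : seq int :=
  [seq entry a i * entry b i | i <- iota 1 n].

Definition diff_product (a b : seq int) (i j : nat) : int :=
  (entry a i - entry a j) * (entry b i - entry b j).

Definition symdiff (a b : seq int) (p q : nat) : int :=
  \sum_(p <= i < q.+1) \sum_(p <= j < q.+1 | (i < j)%N && (i + j == p + q)%N)
    diff_product a b i j.

Definition tare_entry (n : nat) (a b : seq int) (k : nat) : int :=
  \sum_(1 <= i < n.+1) \sum_(1 <= j < n.+1 | (i < j)%N && (i + j == k + 1)%N)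
    diff_product a b i j.

Definition tare (n : nat) (a b : seq int) : seq int :=
  [seq tare_entry n a b k | k <- iota 1 (2 * n - 1)].

(* Main.v *)
(** With weights [w i = 10 ^ (n - i)], the product is the double sum of
    [w i * w j * (a i * b j)], while [C * (1, ..., 1)] is the double sum of
    [w i * w j * (a i * b i)].  The terms of indices [(i, j)] and [(j, i)] of
    the difference add up to [w i * w j * (a i - a j) * (b i - b j)], and since
    [w i * w j = 10 ^ (2 * n - (i + j))], grouping these by [i + j = k + 1]
    gives the tare. *)
Require Import Defs.
From mathcomp Require Import all_boot all_order all_algebra.
From mathcomp Require Import zify ring.

Set Implicit Arguments.
Unset Strict Implicit.
Unset Printing Implicit Defensive.

Import Order.TTheory GRing.Theory Num.Theory.
Local Open Scope ring_scope.

Section NatSums.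

Variable V : zmodType.

Lemma sum_nat_support (m n p q : nat) (F : nat -> V) :
    (m <= p)%N -> (q <= n)%N ->
    (forall i, (m <= i < n)%N -> ~~ (p <= i < q)%N -> F i = 0) ->
  \sum_(m <= i < n) F i = \sum_(p <= i < q) F i.
Proof.
move=> mp qn F0; rewrite (big_nat_widenl p m) // (big_nat_widen m q n) //.
rewrite [RHS]big_mkcond; apply: eq_big_nat => i mn.
by case: ifP => // /negbT; rewrite andTb => /(F0 _ mn).
Qed.

Lemma sum_nat_pairs (m n : nat) (F : nat -> nat -> V) :
    (forall i, F i i = 0) ->
  \sum_(m <= i < n) \sum_(m <= j < n) F i j =
  \sum_(m <= i < n) \sum_(m <= j < n | (i < j)%N) (F i j + F j i).
Proof.
move=> F0; under [RHS]eq_bigr do rewrite big_split /=.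
rewrite big_split /= [X in _ = _ + X](exchange_big_dep_nat xpredT) //=.
rewrite -big_split /=; apply: eq_bigr => i _.
rewrite (bigID (fun j => (i < j)%N)) /=; congr (_ + _).
rewrite big_mkcond [RHS]big_mkcond; apply: eq_bigr => j _.
by case: ltngtP => //= ->.
Qed.

Lemma sum_nat_select (m n p : nat) (c : V) : (m <= p < n)%N ->
  \sum_(m <= k < n | k == p) c = c.
Proof.
by move=> pmn; rewrite big_nat1_eq pmn.
Qed.

End NatSums.

Lemma weighted_sum_mul (R : comNzRingType) (m n : nat) (w x y : nat -> R) :
  (\sum_(m <= i < n) x i * w i) * (\sum_(m <= j < n) y j * w j) =
  (\sum_(m <= i < n) x i * y i * w i) * (\sum_(m <= j < n) w j)
  - \sum_(m <= i < n) \sum_(m <= j < n | (i < j)%N)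
      (x i - x j) * (y i - y j) * (w i * w j).
Proof.
rewrite !big_distrlr /=; set P := LHS; set Q := (X in X - _).
(* Isolating [Q - P] leaves one double sum with zero diagonal, ready to be folded along it. *)
suff <- : Q - P = \sum_(m <= i < n) \sum_(m <= j < n | (i < j)%N)
    (x i - x j) * (y i - y j) * (w i * w j) by rewrite subKr.
rewrite -sumrB; under eq_bigr do rewrite -sumrB.
rewrite sum_nat_pairs => [|i]; last by ring.
by apply: eq_bigr => i _; apply: eq_bigr => j _; ring.
Qed.

Section Tare.

Variables (n : nat) (a b : seq int).

Lemma tare_entry_eq0 (k : nat) :
    (forall i j, (1 <= i)%N -> (i < j <= n)%N -> i + j <> k + 1)%N ->
  tare_entry n a b k = 0.
Proof.
move=> H; rewrite /tare_entry big_nat big1 // => i Hi.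
rewrite big_nat_cond big1 // => j /andP[Hj /andP[ij /eqP E]].
by case: (@H i j); lia.
Qed.

(** Both halves of the tare are covered. If [p = 1], then [i + j = 1 + q] with positive indices
    keeps both at most [q]; if [q = n], then [i + j = p + n] with indices at most [n] keeps both at
    least [p]. *)
Lemma tare_entry_symdiff (k p q : nat) :
    (1 <= p)%N -> (q <= n)%N -> (p + q = k + 1)%N -> (p == 1)%N || (q == n) ->
  tare_entry n a b k = symdiff a b p q.
Proof.
move=> p1 qn pq end_pq; rewrite /tare_entry /symdiff pq.
rewrite (@sum_nat_support _ 1 n.+1 p q.+1) // => [|i Hi Ni]; last first.
  by rewrite big_nat_cond big1 // => j Hj; lia.
apply: eq_big_nat => i Hi; rewrite big_mkcond [RHS]big_mkcond /=.
by rewrite (@sum_nat_support _ 1 n.+1 p q.+1) // => j Hj Nj; case: ifP => //; lia.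
Qed.

Lemma sum_tare_entry :
  \sum_(1 <= k < 2 * n) tare_entry n a b k * 10 ^+ (2 * n - 1 - k) =
  \sum_(1 <= i < n.+1) \sum_(1 <= j < n.+1 | (i < j)%N)
    diff_product a b i j * (10 ^+ (n - i) * 10 ^+ (n - j)).
Proof.
rewrite /tare_entry; under eq_bigr do rewrite mulr_suml.
rewrite exchange_big_nat /=; apply: eq_big_nat => i Hi.
under eq_bigr do rewrite mulr_suml.
(* The sum over [k] becomes innermost and carries the condition [i + j = k + 1]; only [i < j] stays
   on [j]. *)
rewrite (exchange_big_dep_nat (fun j => (i < j)%N)) /=; last first.
  by move=> k j _ _ _ /andP[].
rewrite big_nat_cond [RHS]big_nat_cond; apply: eq_bigr => j /andP[Hj ij].
(* The right-hand term is expanded into a sum over the single index [k = i + j - 1], which lies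
   below [2 * n]. *)
rewrite -(@sum_nat_select _ 1 (2 * n) (i + j - 1) (_ * (_ * _))); last lia.
rewrite big_nat_cond [RHS]big_nat_cond; apply: eq_big => [k|k Hk]; first lia.
(* As [i] and [j] are at most [n], no subtraction truncates in
   [(n - i) + (n - j) = 2 * n - 1 - k]. *)
by rewrite -exprD; congr (_ * _ ^+ _); lia.
Qed.

End Tare.

Lemma decval_map_iota (F : nat -> int) (m : nat) :
  decval [seq F k | k <- iota 1 m] = \sum_(1 <= k < m.+1) F k * 10 ^+ (m - k).
Proof.
rewrite /decval size_map size_iota; apply: eq_big_nat => k Hk.
(* The shift [k.-1] in [entry] cancels the start of [iota] at 1, and stays in bounds. *)
rewrite /entry (nth_map 0%N) ?size_iota ?nth_iota; try lia.
by congr (F _ * _); lia.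
Qed.

Lemma sum_pow10_rev (n : nat) :
  \sum_(1 <= j < n.+1) 10 ^+ (n - j) = \sum_(0 <= j < n) 10 ^+ j :> int.
Proof.
rewrite big_add1 /= [RHS]big_nat_rev /=; apply: eq_big_nat => j Hj.
by congr (_ ^+ _); lia.
Qed.

Lemma decval_nseq1 (n : nat) : decval (nseq n 1) = \sum_(0 <= j < n) 10 ^+ j.
Proof.
rewrite /decval size_nseq -sum_pow10_rev; apply: eq_big_nat => j Hj.
by rewrite /entry nth_nseq ifT ?mul1r //; lia.
Qed.

Theorem mainTheorem2 (n : nat) (hn : (1 <= n)%N) (a b : n.-tuple int)
    (ha : is_digit_seq a) (hb : is_digit_seq b) :
  [/\ tare_entry n a b 1 = 0 /\ tare_entry n a b (2 * n - 1)%N = 0,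
      forall k : nat, (2 <= k <= n)%N ->
        tare_entry n a b k = symdiff a b 1 k,
      forall k : nat, (n <= k <= 2 * n - 2)%N ->
        tare_entry n a b k = symdiff a b (k - n + 1)%N n,
      decval a * decval b =
        decval (vertical_product n a b) * decval (nseq n 1)
        - decval (tare n a b) &
      decval a * decval b =
        (\sum_(1 <= i < n.+1) (entry a i * entry b i) * 10 ^+ (n - i))
        * (\sum_(0 <= j < n) 10 ^+ j)
        - \sum_(1 <= k < 2 * n)
            tare_entry n a b k * 10 ^+ (2 * n - 1 - k)].
Proof.
have mul_ab : decval a * decval b =
    (\sum_(1 <= i < n.+1) (entry a i * entry b i) * 10 ^+ (n - i))
    * (\sum_(0 <= j < n) 10 ^+ j)
    - \sum_(1 <= k < 2 * n) tare_entry n a b k * 10 ^+ (2 * n - 1 - k).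
  by rewrite /decval !size_tuple weighted_sum_mul sum_pow10_rev sum_tare_entry.
split=> //.
(* Two distinct indices in [1..n] have a sum between 3 and [2 * n - 1], so neither 2 nor [2 * n]
   occurs. *)
- by split; apply: tare_entry_eq0 => i j; lia.
- by move=> k Hk; apply: tare_entry_symdiff => //; lia.
- by move=> k Hk; apply: tare_entry_symdiff => //; lia.
rewrite mul_ab !decval_map_iota decval_nseq1.
(* The two upper bounds agree because [n] is positive. *)
by have -> : (2 * n - 1).+1 = (2 * n)%N by lia.
Qed.
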